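(* There exists a convex function $g\ge 0$ on $\mathbb{R}^n$ with $g(0)=0$ such that if $m>0$, then there is no solution to $$\inf\{\mathcal{E}(E): |E|=m\},$$ i.e. there is no set $E_m\subset\mathbb{R}^n$ with $|E_m|=m$ attaining this infimum.
   Context: Here $\alpha\in(0,1)$, the sets $E\subset\mathbb{R}^n$ are measurable, and $|\cdot|$ applied to a set is Lebesgue measure. The nonlocal perimeter is $$P_\alpha(E)=\int_E\int_{E^c}\frac{1}{|x-y|^{n+\alpha}}\,dx\,dy,$$ the potential energy is $\mathcal{G}(E)=\int_E g(x)\,dx$, and the nonlocal free energy is $\mathcal{E}(E)=P_\alpha(E)+\mathcal{G}(E)$.
   Formalization: The formal statement assumes n ≥ 2; for n = 1 the claim is false, since a convex g ≥ 0 with g(0) = 0 either vanishes on a half-line (intervals there minimize) or tends to infinity on both sides (minimizers exist by compactness); for n = 0 it fails at m = 1. *)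

(* Defs.v *)
From HB Require Import structures.
From mathcomp Require Import all_boot all_order all_algebra.
From mathcomp Require Import all_classical all_reals all_analysis.

Set Implicit Arguments.
Unset Strict Implicit.
Unset Printing Implicit Defensive.

Import Order.TTheory GRing.Theory Num.Theory.

Import numFieldNormedType.Exports.
Local Open Scope classical_set_scope.
Local Open Scope ring_scope.

(* The library has no Lebesgue measure on R^n.  It is built here from coverings
   by countably many half-open boxes: first the outer measure [lebesgue_outer],
   then the library's Caratheodory construction, whose measurable sets are the
   Lebesgue measurable (not only the Borel) sets of 'rV[R]_n. *)
Section lebesgue_rV.
Context {R : realType} {n : nat}.

(* [Some (a, b)] is the product of the intervals ]a_i, b_i] and [None] is the
   empty set, so that coverings may be finite.  [None] changes the outer measure
   only for n = 0, where every [Some _] is the whole space and has volume 1. *)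
Definition box (c : option ('rV[R]_n * 'rV[R]_n)) : set 'rV[R]_n :=
  if c is Some (a, b) then [set x | forall i, a 0 i < x 0 i <= b 0 i]
  else set0.

Definition box_volume (c : option ('rV[R]_n * 'rV[R]_n)) : R :=
  if c is Some (a, b) then \prod_(i < n) Num.max 0 (b 0 i - a 0 i) else 0.

Definition lebesgue_outer (A : set 'rV[R]_n) : \bar R :=
  ereal_inf [set (\sum_(0 <= k <oo) (box_volume (B k))%:E)%E
            | B in [set B | A `<=` \bigcup_k box (B k)]].

Lemma box_volume_ge0 c : 0 <= box_volume c.
Proof.
by case: c => [[a b]|]//=; apply: prodr_ge0 => i _; rewrite le_max lexx.
Qed.

Lemma lebesgue_outer_ge0 A : (0 <= lebesgue_outer A)%E.
Proof.
apply: le_ereal_inf_tmp => _ [B _ <-]; apply: nneseries_ge0 => k _ _.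
by rewrite lee_fin box_volume_ge0.
Qed.

Lemma lebesgue_outer0 : lebesgue_outer set0 = 0%E.
Proof.
apply/eqP; rewrite eq_le lebesgue_outer_ge0 andbT.
by apply: ereal_inf_lbound; exists (fun=> None) => //=; rewrite eseries0.
Qed.

Lemma le_lebesgue_outer :
  {homo lebesgue_outer : A B / A `<=` B >-> (A <= B)%E}.
Proof.
move=> A B AB; apply: ereal_inf_le_tmp => _ [C BC <-].
by exists C => //; exact: subset_trans BC.
Qed.

Local Open Scope ereal_scope.

Lemma lebesgue_outer_sigma_subadditive : sigma_subadditive lebesgue_outer.
Proof.
move=> A; have [[i ioo]|] := pselect (exists i, lebesgue_outer (A i) = +oo).
  rewrite (eseries_pinfty _ _ ioo) ?leey// => k _.
  by rewrite -ltNye (lt_le_trans _ (lebesgue_outer_ge0 _)).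
rewrite -forallNE => Aoo.
apply/lee_addgt0Pr => _/posnumP[e].
rewrite (le_trans _ (epsilon_trick _ _ _))//; last first.
  by move=> k; exact: lebesgue_outer_ge0.
pose P k (B : nat -> option ('rV[R]_n * 'rV[R]_n)) :=
  A k `<=` \bigcup_j box (B j) /\
  \sum_(0 <= j <oo) (box_volume (B j))%:E <=
    lebesgue_outer (A k) + (e%:num / (2 ^ k.+1)%:R)%:E.
have [G PG] : {G : nat -> nat -> option ('rV[R]_n * 'rV[R]_n)
                 & forall k, P k (G k)}.
  apply: (@choice _ _ P) => k; rewrite /P /lebesgue_outer.
  set S := (X in ereal_inf X); move infS : (ereal_inf S) => iS.
  case: iS infS => [r Sr|Soo|Soo].
  - have en1 : (0 < e%:num / (2 ^ k.+1)%:R)%R by [].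
    have /(lb_ereal_inf_adherent en1) : ereal_inf S \is a fin_num by rewrite Sr.
    move=> [x [B AB muBx] xS].
    by exists B; split => //; rewrite muBx -Sr; exact/ltW.
  - by have := Aoo k; rewrite /lebesgue_outer Soo.
  - by have := lebesgue_outer_ge0 (A k); rewrite /lebesgue_outer Soo.
pose vol (ij : nat * nat) := (box_volume (G ij.1 ij.2))%:E.
have vol_ge0 ij : 0 <= vol ij by rewrite lee_fin box_volume_ge0.
apply: (@le_trans _ _ (\esum_(i in setT) vol i)).
  apply: ereal_inf_lbound => /=.
  have /card_esym/ppcard_eqP[f] := card_nat2.
  exists (fun i => G (f i).1 (f i).2).
    move=> t [i _ Ait]; have [j _ Gijt] := (PG i).1 _ Ait.
    by exists (f^-1%FUN (i, j)) => //=; rewrite invK ?inE.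
  rewrite nneseries_esumT; last by move=> i; rewrite lee_fin box_volume_ge0.
  by rewrite (reindex_esum setT setT f)//; exact: bijT.
rewrite (_ : setT = setT `*`` (fun=> setT)); last first.
  by apply/seteqP; split.
rewrite -(@esum_esum _ _ _ setT (fun=> setT) (fun i j => vol (i, j)))//.
rewrite nneseries_esumT; last first.
  by move=> k; rewrite adde_ge0 ?lebesgue_outer_ge0// lee_fin.
apply: le_esum => i _; apply: le_trans (PG i).2.
by rewrite nneseries_esumT// => k; rewrite lee_fin box_volume_ge0.
Qed.

HB.instance Definition _ := isOuterMeasure.Build R _ lebesgue_outer
  lebesgue_outer0 lebesgue_outer_ge0 le_lebesgue_outer
  lebesgue_outer_sigma_subadditive.

Definition lebesgue_rV : set (caratheodory_type lebesgue_outer) -> \bar R :=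
  lebesgue_outer.

HB.instance Definition _ := isMeasure.Build _ _ _ lebesgue_rV
  (@caratheodory_measure0 _ _ lebesgue_outer)
  (@caratheodory_measure_ge0 _ _ lebesgue_outer)
  (@caratheodory_measure_sigma_additive _ _ lebesgue_outer).

End lebesgue_rV.

Definition lebesgue_measurable {R : realType} {n : nat} (E : set 'rV[R]_n) :=
  measurable (E : set (caratheodory_type lebesgue_outer)).

(* The library norm on 'rV[R]_n is the maximum norm. *)
Definition enorm {R : realType} {n : nat} (x : 'rV[R]_n) : R :=
  Num.sqrt (\sum_(i < n) x 0 i ^+ 2).

Section nonlocal_free_energy.
Context {R : realType} {n : nat}.
Local Notation mu := (@lebesgue_rV R n).
Local Open Scope ereal_scope.

Definition nonlocal_perimeter (alpha : R) (E : set 'rV[R]_n) : \bar R :=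
  \int[mu]_(y in E) \int[mu]_(x in ~` E)
    ((enorm (x - y)%R `^ (n%:R + alpha))^-1)%R%:E.

Definition potential_energy (g : 'rV[R]_n -> R) (E : set 'rV[R]_n) : \bar R :=
  \int[mu]_(x in E) (g x)%:E.

Definition free_energy (alpha : R) (g : 'rV[R]_n -> R) (E : set 'rV[R]_n) :
    \bar R :=
  nonlocal_perimeter alpha E + potential_energy g E.

Definition admissible (m : R) : set (set 'rV[R]_n) :=
  [set E | lebesgue_measurable E /\ mu E = m%:E].

Definition is_minimizer (alpha : R) (g : 'rV[R]_n -> R) (m : R)
    (E : set 'rV[R]_n) : Prop :=
  admissible m E /\
  free_energy alpha g E = ereal_inf (free_energy alpha g @` admissible m).

End nonlocal_free_energy.

(* Main.v *)
Require Import Defs.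
From mathcomp Require Import all_boot all_order all_algebra.
From mathcomp Require Import all_classical all_reals all_analysis.
From mathcomp Require Import measurable_realfun.
From mathcomp Require Import lra ring.

Import Order.TTheory GRing.Theory Num.Theory.
Import numFieldNormedType.Exports.

Local Open Scope classical_set_scope.
Local Open Scope ring_scope.

(** The potential is [g x = sqrt (x_i ^ 2 + x_j ^ 2) - x_i] for two distinct
coordinates [i], [j], which exist as [2 <= n].  It is convex, nonnegative and
zero at the origin, and it decreases along the [i]-th axis, strictly so off the
null hyperplane [x_j = 0].  Hence moving a set [E] of positive measure by one
unit along that axis keeps its measure and its nonlocal perimeter, and lowers
its potential energy strictly as soon as that energy is finite
([potential_energy_translation_lt]).  A minimizer of finite energy would thus be
beaten by its own translate.

What remains is that a minimizer has finite energy, that is, that some set of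
measure [m] does; otherwise the infimum would be infinite and every set of
measure [m] would attain it.  A cube of the right size is such a set.  For its
perimeter ([nonlocal_perimeter_cube_lty]) the kernel is cut into the dyadic
shells [h <= |x - y| < 2 h].  If [y] is in the cube, [x] is outside and
[|x - y| < 2 h], then [y] is in the layer of width [2 h] along the faces, so the
shell contributes at most a constant times
[h ^ - (n + alpha) * h ^ n * min (1, h) = h ^ - alpha * min (1, h)].  Over
[h = 2 ^ k] these are two geometric series: for large [h] the ratio is
[2 ^ - alpha], which is less than 1 as [alpha > 0], and for small [h] it is
[2 ^ (alpha - 1)], which is less than 1 as [alpha < 1].

Two shortcuts keep the measure theory light.  The exact measure of a box is
never computed: upper bounds come from the definition of the outer measure, and
the unit cube only has to have positive measure, since by scaling some cube has
measure [m].  And the double integral is neither shown measurable nor exchanged: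
integrals of nonnegative functions are suprema over simple functions below, so
monotonicity and translation invariance hold for arbitrary integrands. *)

(** * The outer measure: affine maps, half-spaces, boxes *)

Section outer.
Context {R : realType} {n : nat}.
Implicit Types (A : set 'rV[R]_n) (x y a b t : 'rV[R]_n) (s : R) (i : 'I_n).
Local Notation outer := (@lebesgue_outer R n).

(** Cover by the box itself and then by empty sets. *)
Lemma lebesgue_outer_le_volume A a b :
  A `<=` box (Some (a, b)) -> (outer A <= (box_volume (Some (a, b)))%:E)%E.
Proof.
move=> sAab; apply: ereal_inf_lbound.
exists (fun k => if k == 0%N then Some (a, b) else None).
  by move=> x /sAab abx; exists 0%N.
rewrite (nneseries_split 0 1)//; last first.
  by move=> k _; rewrite lee_fin box_volume_ge0.
rewrite add0n big_nat1 eseries0 ?adde0//.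
by move=> [].
Qed.

(** An affine map of ratio [s] sends a covering by boxes to a covering by boxes
whose volumes are multiplied by [s ^ n]. *)
Lemma outer_image_affine_le s t A : 0 < s ->
  (outer ((fun x => s *: x + t)%R @` A) <= (s ^+ n)%:E * outer A)%E.
Proof.
move=> s0; have sn0 : 0 < s ^+ n by rewrite exprn_gt0.
rewrite -lee_pdivrMl//; apply: le_ereal_inf_tmp => _ [B AB <-].
rewrite lee_pdivrMl// -nneseriesZl; last first.
  by move=> k _; rewrite lee_fin box_volume_ge0.
apply: ereal_inf_lbound.
exists (fun k => omap (fun c => (s *: c.1 + t, s *: c.2 + t)) (B k)).
  move=> _ [x /AB[k _ Bkx] <-]; exists k => //.
  case: (B k) Bkx => [[a b]|]//= abx i.
  by rewrite !mxE lerD2r ltrD2r ler_pM2l// ltr_pM2l.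
apply: eq_eseriesr => k _; rewrite -EFinM; congr (_%:E).
case: (B k) => [[a b]|]/=; last by rewrite mulr0.
rewrite -[in X in s ^+ X](card_ord n) -prodr_const -big_split/=.
apply: eq_bigr => i _; rewrite !mxE maxr_pMr ?(ltW s0)// mulr0; congr Num.max.
by ring.
Qed.

(** The reverse inequality is the previous one for the inverse map. *)
Lemma outer_image_affine s t A : 0 < s ->
  outer ((fun x => s *: x + t)%R @` A) = ((s ^+ n)%:E * outer A)%E.
Proof.
move=> s0; apply/eqP; rewrite eq_le outer_image_affine_le//=.
have si0 : 0 < s^-1 by rewrite invr_gt0.
rewrite -lee_pdivlMl ?exprn_gt0// -exprVn.
apply: le_trans (outer_image_affine_le _ (- (s^-1 *: t)) _ si0).
apply: le_lebesgue_outer => x Ax; exists (s *: x + t); first by exists x.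
by rewrite /= scalerDr scalerA mulVf ?gt_eqF// scale1r addrK.
Qed.

Lemma outer_preimage_translation t A :
  outer ((fun x => x + t)%R @^-1` A) = outer A.
Proof.
rewrite -[RHS]mul1e -(expr1n R n) -(outer_image_affine 1 (- t) A ltr01).
congr outer; apply/seteqP; split=> [x Axt|_ [x Ax <-]] /=.
  by exists (x + t) => //; rewrite scale1r addrK.
by rewrite scale1r subrK.
Qed.

Lemma lebesgue_measurable_preimage_translation t A :
  lebesgue_measurable A -> lebesgue_measurable ((fun x => x + t) @^-1` A).
Proof.
move=> mA; rewrite /lebesgue_measurable.
change (outer.-caratheodory ((fun x => x + t)%R @^-1` A)) => X.
rewrite -(outer_preimage_translation (- t) X).
rewrite -(outer_preimage_translation (- t) (X `&` _)).
rewrite -(outer_preimage_translation (- t) (X `&` ~` _)).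
have K B : (fun x => x - t) @^-1` ((fun x => x + t) @^-1` B) = B.
  by apply/seteqP; split=> x /=; rewrite subrK.
rewrite !preimage_setI -preimage_setC !K.
exact: mA.
Qed.

(** A hyperplane orthogonal to an axis cuts each box of a covering into two
boxes whose volumes add up, so a covering of [X] splits into a covering of each
side of [X], at no cost.  This is the Caratheodory criterion. *)
Lemma measurable_halfspace i (r : R) :
  lebesgue_measurable [set x : 'rV[R]_n | x 0 i <= r].
Proof.
pose lo (c : option ('rV[R]_n * 'rV[R]_n)) :=
  omap (fun p : 'rV[R]_n * 'rV[R]_n =>
  (p.1, \row_j (if j == i then Num.min (p.2 0 j) r else p.2 0 j))) c.
pose hi (c : option ('rV[R]_n * 'rV[R]_n)) :=
  omap (fun p : 'rV[R]_n * 'rV[R]_n =>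
  (\row_j (if j == i then Num.max (p.1 0 j) r else p.1 0 j), p.2)) c.
have volE c : box_volume c = box_volume (lo c) + box_volume (hi c).
  case: c => [[a b]|]/=; last by rewrite addr0.
  rewrite (bigD1 i)//= [X in _ = X + _](bigD1 i)//=.
  rewrite [X in _ = _ + X](bigD1 i)//=.
  rewrite !mxE eqxx.
  (* Both halves have the same sides as [c] in the other directions. *)
  rewrite [X in _ = _ * X + _](eq_bigr (fun j => Num.max 0 (b 0 j - a 0 j)));
    last by move=> j /negbTE ji; rewrite !mxE ji.
  rewrite [X in _ = _ + _ * X](eq_bigr (fun j => Num.max 0 (b 0 j - a 0 j)));
    last by move=> j /negbTE ji; rewrite !mxE ji.
  rewrite -mulrDl; congr (_ * _).
  move: (a 0 i) (b 0 i) => u v.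
  rewrite /Num.max /Num.min.
  by repeat case: ifPn => //; rewrite -?leNgt; lra.
apply: le_caratheodory_measurable => X; apply: le_ereal_inf_tmp => _ [B XB <-].
rewrite (eq_eseriesr (fun k _ => congr1 EFin (volE (B k)))).
under eq_eseriesr do rewrite EFinD.
rewrite nneseriesD; try by move=> k _ _; rewrite lee_fin box_volume_ge0.
apply: leeD; apply: ereal_inf_lbound.
- exists (lo \o B) => // x [/XB[k _ Bkx] /= xr]; exists k => //=.
  case: (B k) Bkx => [[a b]|]//= abx j; have /andP[-> /= xb] := abx j.
  by rewrite mxE; case: eqP => // ji; rewrite le_min xb ji.
- exists (hi \o B) => // x [/XB[k _ Bkx] /= /negP]; rewrite -ltNge => xr.
  exists k => //=.
  case: (B k) Bkx => [[a b]|]//= abx j; have /andP[xa ->] := abx j.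
  by rewrite mxE andbT; case: eqP => // ji; rewrite gt_max xa ji.
Qed.

End outer.

Section measure.
Context {R : realType} {n : nat}.
Implicit Types (x y a b t : 'rV[R]_n) (s : R) (i : 'I_n).
Local Notation T := (caratheodory_type (@lebesgue_outer R n)).
Local Notation mu := (@lebesgue_rV R n).

Lemma measurable_coordinate i :
  measurable_fun [set: T] (fun x : T => (x : 'rV[R]_n) 0 i).
Proof.
apply: (measurability _ (RGenOInfty.measurableE R)) => //.
move=> _ [_ [r ->] <-]; rewrite setTI.
rewrite (_ : _ @^-1` _ = ~` [set x : T | (x : 'rV[R]_n) 0 i <= r]).
  by apply: measurableC; exact: measurable_halfspace.
by apply/seteqP; split=> x /=; rewrite in_itv/= andbT ltNge => /negP.
Qed.

Lemma measurable_box (c : option ('rV[R]_n * 'rV[R]_n)) :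
  measurable (box c : set T).
Proof.
case: c => [[a b]|]/=; last exact: measurable0.
rewrite [X in measurable X](_ : _ = \bigcap_(i in [set: 'I_n])
   ((fun x : T => (x : 'rV[R]_n) 0 i) @^-1` `]a 0 i, b 0 i]%classic)).
  apply: fin_bigcap_measurable => // i _.
  by rewrite -[X in measurable X]setTI; apply: measurable_coordinate.
apply/seteqP; split=> [x abx i _ /=|x abx i]; first by rewrite in_itv/= abx.
by have := abx i Logic.I; rewrite /= in_itv.
Qed.

End measure.

(** * Integrals of arbitrary nonnegative functions; translations *)

Section integral_nomeas.
Context d {T : measurableType d} {R : realType}
  (mu : {measure set T -> \bar R}).
Local Open Scope ereal_scope.
Import HBNNSimple.

(** The integral of a nonnegative function is the supremum of the integrals of
the simple functions below it, and a larger function has more of them; this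
compares arbitrary functions. *)
Lemma ge0_le_integral_arbitrary (D : set T) (f g : T -> \bar R) :
  (forall x, D x -> 0 <= f x) -> (forall x, D x -> f x <= g x) ->
  \int[mu]_(x in D) f x <= \int[mu]_(x in D) g x.
Proof.
move=> f0 fg; have g0 x : D x -> 0 <= g x.
  by move=> Dx; exact: le_trans (f0 x Dx) (fg x Dx).
rewrite !ge0_integralE//=; apply: ereal_sup_le => _ [h /= hf <-].
exists h => //= x; apply: le_trans (hf x) _.
by rewrite !patchE; case: ifPn => // /set_mem/fg.
Qed.

(** A simple function below [f] becomes, composed with [tau], a simple function
of the same integral below [f \o tau].  Only simple functions are pushed
forward, so [f] itself may be arbitrary. *)
Lemma ge0_integral_preserving_le (tau : T -> T) (f : T -> \bar R) :
  measurable_fun setT tau ->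
  (forall A, measurable A -> mu (tau @^-1` A) = mu A) ->
  (forall x, 0 <= f x) ->
  \int[mu]_x f x <= \int[mu]_x f (tau x).
Proof.
move=> mtau mutau f0; rewrite ge0_integralTE//=.
apply: ge_ereal_sup => _ [h hf <-].
rewrite (_ : sintegral mu h = \int[mu]_x (h (tau x))%:E); last first.
  transitivity (\int[mu]_x (h x)%:E).
    by rewrite integral_nnsfun// patch_setT.
  rewrite (@eq_measure_integral _ _ _ setT (pushforward mu tau)) => [|A mA _].
    rewrite ge0_integral_pushforward//; first by apply/measurable_EFinP.
    by move=> y _; rewrite lee_fin.
  exact/esym/mutau.
apply: ge0_le_integral_arbitrary => x _; first by rewrite lee_fin.
exact: hf.
Qed.

End integral_nomeas.

Section translation.
Context {R : realType} {n : nat}.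
Implicit Types (x y a b t : 'rV[R]_n) (s : R) (i : 'I_n) (E : set 'rV[R]_n).
Local Notation T := (caratheodory_type (@lebesgue_outer R n)).
Local Notation mu := (@lebesgue_rV R n).
Local Open Scope ereal_scope.

Lemma measurable_translation t :
  measurable_fun [set: T] ((fun x => x + t)%R : T -> T).
Proof.
move=> _ A mA; rewrite setTI.
exact: lebesgue_measurable_preimage_translation.
Qed.

(** Measure-preserving maps give one inequality; translating back gives the
other. *)
Lemma ge0_integral_translation t E (f : 'rV[R]_n -> \bar R) :
  (forall x, 0 <= f x) ->
  \int[mu]_(x in (fun x => x + t)%R @^-1` E) f (x + t)%R =
  \int[mu]_(x in E) f x.
Proof.
move=> f0; rewrite [LHS]integral_mkcond [RHS]integral_mkcond.
have le u (g : T -> \bar R) : (forall x, 0 <= g x) ->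
    \int[mu]_x g x <= \int[mu]_x g (x + u : 'rV[R]_n)%R.
  move=> g0.
  apply: (@ge0_integral_preserving_le _ T R mu (fun x => x + u : 'rV[R]_n)%R g
    (measurable_translation u) _ g0) => A _.
  exact: outer_preimage_translation.
have f0' (D : set T) (h : T -> \bar R) : (forall x, 0 <= h x) ->
    forall x, 0 <= (h \_ D) x.
  by move=> h0 x; rewrite patchE; case: ifP.
have E1 : (fun x : T => (f \_ E) (x + t : 'rV[R]_n)%R) =
          (fun x : T => f (x + t)%R) \_ ((fun x => x + t)%R @^-1` E).
  by [].
rewrite -E1; apply/eqP; rewrite eq_le; apply/andP; split; last first.
  by apply: (le t (f \_ E)) => x; exact: f0'.
have /= := le (- t)%R (fun x : T => (f \_ E) (x + t : 'rV[R]_n)%R).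
under [X in _ -> _ <= X]eq_integral do rewrite subrK.
by apply=> x; exact: f0'.
Qed.

(** The kernel depends on [x - y] only. *)
Lemma nonlocal_perimeter_translation alpha t E :
  nonlocal_perimeter alpha ((fun x => x + t)%R @^-1` E) =
  nonlocal_perimeter alpha E.
Proof.
rewrite /nonlocal_perimeter -[RHS](ge0_integral_translation t) => [|y].
  apply: eq_integral => y _; rewrite -[RHS](ge0_integral_translation t).
    by apply: eq_integral => x _; rewrite opprD addrACA subrr addr0.
  by move=> x; rewrite lee_fin invr_ge0 powR_ge0.
by apply: integral_ge0 => x _; rewrite lee_fin invr_ge0 powR_ge0.
Qed.

Lemma nonlocal_perimeter_ge0 alpha E : 0 <= nonlocal_perimeter alpha E.
Proof.
apply: integral_ge0 => y _; apply: integral_ge0 => x _.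
by rewrite lee_fin invr_ge0 powR_ge0.
Qed.

Lemma potential_energy_ge0 (g : 'rV[R]_n -> R) E :
  (forall x, (0 <= g x)%R) -> 0 <= potential_energy g E.
Proof. by move=> g0; apply: integral_ge0 => x _; rewrite lee_fin. Qed.

Lemma admissible_translation m t E :
  admissible m E -> admissible m ((fun x => x + t)%R @^-1` E).
Proof.
move=> [mE muE]; split; first exact: lebesgue_measurable_preimage_translation.
rewrite -muE; exact: outer_preimage_translation.
Qed.

(** The bounded part of the hyperplane lies in boxes that are arbitrarily thin
in the direction [i]; the hyperplane is the countable union of such parts. *)
Lemma hyperplane_null i : mu [set x : T | (x : 'rV[R]_n) 0%R i = 0%R] = 0.
Proof.
pose S k := [set x : 'rV[R]_n | x 0%R i = 0%R /\ forall j, (`|x 0 j| < k%:R)%R].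
have S0 k : lebesgue_outer (S k) = 0.
  apply/eqP; rewrite eq_le lebesgue_outer_ge0 andbT.
  apply/lee_addgt0Pr => e e0; rewrite add0e.
  pose P : R := (\prod_(j < n | j != i) Num.max 0 (k%:R - - k%:R))%R.
  have P0 : (0 < P + 1)%R.
    by rewrite ltr_wpDl// prodr_ge0// => j _; rewrite le_max lexx.
  (* The thickness [e / (P + 1)] makes the volume at most [e]; adding 1 avoids a
     division by zero when [k = 0]. *)
  pose a : 'rV[R]_n := (\row_j (if j == i then - (e / (P + 1)) else - k%:R))%R.
  pose b : 'rV[R]_n := (\row_j (if j == i then 0 else k%:R))%R.
  apply: (@le_trans _ _ (box_volume (Some (a, b)))%:E).
    apply: lebesgue_outer_le_volume => x [xi0 xk] j.
    rewrite !mxE; case: eqP => [->|_].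
      by rewrite xi0 lexx oppr_lt0 divr_gt0.
    by have := xk j; rewrite ltr_norml => /andP[-> /ltW].
  rewrite lee_fin /= (bigD1 i)//= !mxE eqxx sub0r opprK.
  rewrite max_r; last by rewrite divr_ge0 ?(ltW e0) ?(ltW P0).
  rewrite (eq_bigr (fun=> Num.max 0 (k%:R - - k%:R))%R); last first.
    by move=> j /negbTE ji; rewrite !mxE ji.
  by rewrite -/P -mulrA ler_piMr ?(ltW e0)// mulrC ler_pdivrMr// mul1r lerDl.
apply/eqP; rewrite eq_le measure_ge0 andbT.
apply: (@le_trans _ _ (lebesgue_outer (\bigcup_k S k))).
  (* The sum of the absolute values of the coordinates bounds each of them. *)
  apply: le_lebesgue_outer => x /= xi0.
  exists (Num.trunc (\sum_j `|x 0%R j|)%R).+1 => //; split=> // j.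
  apply: le_lt_trans (truncnS_gt _).
  by rewrite (bigD1 j)//= lerDl sumr_ge0.
apply: (le_trans (lebesgue_outer_sigma_subadditive S)).
by rewrite eseries0.
Qed.

End translation.

(** * The potential and its strict decrease under translation *)

Section radial_excess.
Context {R : realType}.
Implicit Types a b c d : R.

(** The triangle inequality in the plane, whence the convexity of the
potential.  It rests on Cauchy-Schwarz, in the form
[(a ^ 2 + b ^ 2) (c ^ 2 + d ^ 2) - (a c + b d) ^ 2 = (a d - b c) ^ 2]. *)
Lemma sqrt_sumsq_triangle a b c d :
  Num.sqrt ((a + c) ^+ 2 + (b + d) ^+ 2) <=
  Num.sqrt (a ^+ 2 + b ^+ 2) + Num.sqrt (c ^+ 2 + d ^+ 2).
Proof.
have := sqr_sqrtr (addr_ge0 (sqr_ge0 a) (sqr_ge0 b)).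
have := sqr_sqrtr (addr_ge0 (sqr_ge0 c) (sqr_ge0 d)).
have := sqrtr_ge0 (c ^+ 2 + d ^+ 2); have := sqrtr_ge0 (a ^+ 2 + b ^+ 2).
set p := Num.sqrt (a ^+ 2 + b ^+ 2); set q := Num.sqrt (c ^+ 2 + d ^+ 2).
move=> p0 q0 q2 p2.
have pq : a * c + b * d <= p * q.
  rewrite leNgt; apply/negP => lt_pq.
  have : (p * q) ^+ 2 < (a * c + b * d) ^+ 2.
    by rewrite ltrXn2r// ?mulr_ge0// (le_trans _ (ltW lt_pq))// mulr_ge0.
  rewrite exprMn p2 q2; apply/negP; rewrite -leNgt -subr_ge0.
  by rewrite (_ : _ - _ = (a * d - b * c) ^+ 2) ?sqr_ge0//; ring.
rewrite -[p + q]ger0_norm ?addr_ge0// -sqrtr_sqr; apply: ler_wsqrtr.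
rewrite -subr_ge0 [_ - _](_ : _ = p ^+ 2 + q ^+ 2 + p * q *+ 2
    - (a ^+ 2 + b ^+ 2 + (c ^+ 2 + d ^+ 2) + (a * c + b * d) *+ 2)); last first.
  by ring.
by rewrite p2 q2 subr_ge0 lerD2l lerMn2r.
Qed.

(** The distance from [(u, v)] to the origin minus its first coordinate: the
positive level sets are confocal parabolas around the half-line [u >= 0],
[v = 0], which is the zero set. *)
Definition radial_excess u v : R := Num.sqrt (u ^+ 2 + v ^+ 2) - u.

Lemma radial_excess_ge0 u v : 0 <= radial_excess u v.
Proof.
rewrite subr_ge0 (le_trans (ler_norm u))// -sqrtr_sqr ler_wsqrtr//.
by rewrite lerDl sqr_ge0.
Qed.

Lemma radial_excess_gt0 u v : v != 0 -> 0 < radial_excess u v.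
Proof.
move=> v0; rewrite subr_gt0 (le_lt_trans (ler_norm u))// -sqrtr_sqr.
have v20 : 0 < v ^+ 2 by rewrite exprn_even_gt0.
by rewrite ltr_sqrt ?ltrDl// ltr_wpDl// sqr_ge0.
Qed.

Lemma radial_excess_decr u v : radial_excess (u + 1) v <= radial_excess u v.
Proof.
rewrite /radial_excess; have := sqrt_sumsq_triangle u v 1 0.
by rewrite addr0 expr0n expr1n addr0 sqrtr1; lra.
Qed.

(** Squaring turns [|(u + 1, v)| < |(u, v)| + 1] into [u < |(u, v)|]. *)
Lemma radial_excess_strict_decr u v :
  v != 0 -> radial_excess (u + 1) v < radial_excess u v.
Proof.
move=> /(radial_excess_gt0 u); rewrite /radial_excess subr_gt0.
have := sqr_sqrtr (addr_ge0 (sqr_ge0 u) (sqr_ge0 v)).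
have := sqrtr_ge0 (u ^+ 2 + v ^+ 2); set p := Num.sqrt (u ^+ 2 + _).
move=> p0 p2 up; suff : Num.sqrt ((u + 1) ^+ 2 + v ^+ 2) < p + 1 by lra.
rewrite -[p + 1]ger0_norm ?addr_ge0// -sqrtr_sqr ltr_sqrt; last first.
  by rewrite exprn_gt0// ltr_wpDl.
by rewrite sqrrD1 sqrrD1 p2 !mulr2n; lra.
Qed.

End radial_excess.

Section potential.
Context {R : realType} {n : nat} (i j : 'I_n).
Local Notation T := (caratheodory_type (@lebesgue_outer R n)).
Local Notation mu := (@lebesgue_rV R n).

Definition ray_potential (x : 'rV[R]_n) : R := radial_excess (x 0 i) (x 0 j).

Lemma ray_potential_convex : convex_function [set: 'rV[R]_n] ray_potential.
Proof.
move=> t x y _ _; rewrite convRE /ray_potential /radial_excess !mxE.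
have t0 : 0 <= t%:num by exact: ge0.
have t1 : 0 <= unstable.onem t%:num.
  by rewrite /unstable.onem subr_ge0; exact: le1.
move: t0 t1.
move: (t%:num) (unstable.onem t%:num) => {t} s r s0 r0.
rewrite (le_trans (lerB (sqrt_sumsq_triangle _ _ _ _) (lexx _)))//.
have sqrtZ (k u v : R) : 0 <= k ->
    Num.sqrt ((k * u) ^+ 2 + (k * v) ^+ 2) = k * Num.sqrt (u ^+ 2 + v ^+ 2).
  by move=> k0; rewrite !exprMn -mulrDr sqrtrM ?sqr_ge0// sqrtr_sqr ger0_norm.
by rewrite !sqrtZ// !mulrBr opprD addrACA.
Qed.

Lemma measurable_ray_potential :
  measurable_fun [set: T] (ray_potential : T -> R).
Proof.
apply: measurable_funB; last exact: measurable_coordinate.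
apply: (@measurableT_comp _ _ _ _ _ _ (@Num.sqrt R)).
  by apply: continuous_measurable_fun; exact: sqrt_continuous.
by apply: measurable_funD; apply: measurable_funX; exact: measurable_coordinate.
Qed.

(** The energy of [E] is that of its translate plus the integral over [E] of the
drop [h].  If that integral vanished, [h] would be null almost everywhere on
[E], but [h] is positive off the hyperplane [x_j = 0]. *)
Lemma potential_energy_translation_lt (E : set 'rV[R]_n) : i != j ->
  lebesgue_measurable E -> (0 < mu E)%E ->
  (potential_energy ray_potential E < +oo)%E ->
  (potential_energy ray_potential ((fun x => (x - delta_mx 0 i)%R) @^-1` E) <
   potential_energy ray_potential E)%E.
Proof.
move=> ij mE E0 Efin; pose e : 'rV[R]_n := delta_mx 0 i.
pose u (x : T) : R := ray_potential (x + e : 'rV[R]_n).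
pose h (x : T) : R := ray_potential x - u x.
have uE x : u x = radial_excess (x 0 i + 1) (x 0 j).
  by rewrite /u /ray_potential !mxE !eqxx/= eq_sym (negbTE ij) addr0.
have h0 x : 0 <= h x by rewrite subr_ge0 uE radial_excess_decr.
have u0 x : 0 <= u x by rewrite uE radial_excess_ge0.
have mu_ : measurable_fun [set: T] u.
  apply: (@measurableT_comp _ _ _ _ _ _ (ray_potential : T -> R)).
    exact: measurable_ray_potential.
  exact: measurable_translation.
have mh : measurable_fun [set: T] h.
  by apply: measurable_funB; [exact: measurable_ray_potential | exact: mu_].
have -> : potential_energy ray_potential ((fun x => (x - e)%R) @^-1` E) =
    (\int[mu]_(x in E) (u x)%:E)%E.
  rewrite -[RHS](@ge0_integral_translation _ _ (- e)) => [|x]; last first.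
    by rewrite lee_fin.
  by apply: eq_integral => x _; rewrite /u subrK.
have EE : potential_energy ray_potential E =
    (\int[mu]_(x in E) (u x)%:E + \int[mu]_(x in E) (h x)%:E)%E.
  rewrite -(@ge0_integralD _ T R mu E mE); last 4 first.
  - by move=> x _; rewrite lee_fin.
  - by apply/measurable_EFinP; exact: measurable_funTS.
  - by move=> x _; rewrite lee_fin.
  - by apply/measurable_EFinP; exact: measurable_funTS.
  by apply: eq_integral => x _; rewrite -EFinD addrC subrK.
have ufin : (\int[mu]_(x in E) (u x)%:E)%E \is a fin_num.
  rewrite ge0_fin_numE; last by apply: integral_ge0 => x _; rewrite lee_fin.
  apply: le_lt_trans Efin; rewrite EE leeDl//.
  by apply: integral_ge0 => x _; rewrite lee_fin.
rewrite EE lteDl// lt0e integral_ge0 ?andbT; last first.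
  by move=> x _; rewrite lee_fin.
apply/negP => /eqP h_int0.
have /ae_eq_integral_abs : (\int[mu]_(x in E) `|(h x)%:E| = 0)%E.
  by rewrite -h_int0; apply: eq_integral => x _; rewrite gee0_abs// lee_fin.
have mhE : measurable_fun (E : set T) (EFin \o h).
  by apply/measurable_EFinP; exact: measurable_funTS.
move=> /(_ mE mhE)[N [mN N0 sN]].
suff : mu E = 0%E by move=> muE; rewrite muE ltxx in E0.
pose H := [set x : T | (x : 'rV[R]_n) 0 j = 0].
have mH : measurable H.
  rewrite -[H]setTI; apply: (measurable_coordinate j measurableT [set 0]).
  exact: measurable_set1.
apply: (@subset_measure0 _ T R mu E (N `|` H)) => //.
- exact: measurableU.
- move=> x Ex; have [xj0|xj0] := eqVneq ((x : 'rV[R]_n) 0 j) 0; first by right.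
  left; apply: sN => /= /(_ Ex) [] /eqP.
  by rewrite gt_eqF// subr_gt0 uE radial_excess_strict_decr.
- apply/eqP; rewrite eq_le measure_ge0 andbT.
  have NH : (mu (N `|` H) <= mu N + mu H)%E := measureU2 _ mN mH.
  have N0' : mu N = 0%E := N0.
  by move: NH; rewrite N0' [X in (_ + X)%E]hyperplane_null adde0.
Qed.

End potential.

(** * Dyadic scales and cubes *)

Section dyadic.
Context {R : realType}.
Implicit Types (r q C : R).

Lemma ltr_pow2R (a b : R) : a < b -> 2 `^ a < 2 `^ b.
Proof.
by move=> ab; rewrite /powR pnatr_eq0/= ltr_expR ltr_pM2r// ln_gt0// ltr1n.
Qed.

(** The exponent is the floor of the binary logarithm. *)
Lemma dyadic_shell r : 0 < r -> exists z : int, 2 ^ z <= r < 2 * 2 ^ z.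
Proof.
move=> r0; pose z := Num.floor (ln r / ln 2).
have ln2 : 0 < ln 2 :> R by rewrite ln_gt0// ltr1n.
have rE : r = 2 `^ (ln r / ln 2).
  by rewrite /powR pnatr_eq0/= divfK ?gt_eqF// lnK.
exists z; have /andP[zr rz] := floor_itv (ln r / ln 2).
have -> : 2 * 2 ^ z = 2 ^ (z + 1) :> R by rewrite expfzDr// expr1z mulrC.
rewrite -!powR_intmul// {1 2}rE.
by rewrite ler_powR ?ler1n//= ltr_pow2R.
Qed.

Lemma geometric_nneseries_lty C q : 0 <= C -> 0 < q < 1 ->
  (\sum_(0 <= k <oo) (C * q ^+ k)%:E < +oo)%E.
Proof.
move=> C0 /andP[q0 q1].
apply: (@le_lt_trans _ _ (C / (1 - q))%:E); last exact: ltry.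
apply: lime_le.
  apply: is_cvg_nneseries => k _ _.
  by rewrite lee_fin mulr_ge0// exprn_ge0// ltW.
apply: nearW => k; rewrite sumEFin lee_fin.
have := @geometric_le_lim R k C q C0 q0.
by rewrite ger0_norm ?(ltW q0)//; exact.
Qed.

Lemma nneseries_ge_term (u : nat -> R) k : (forall j, 0 <= u j) ->
  ((u k)%:E <= \sum_(0 <= j <oo) (u j)%:E)%E.
Proof.
move=> u0; rewrite (@nneseriesD1 _ _ k)//; last by move=> j _; rewrite lee_fin.
by rewrite leeDl// nneseries_ge0// => j _ _; rewrite lee_fin.
Qed.

End dyadic.

Section cube.
Context {R : realType} {n : nat}.
Implicit Types (x y : 'rV[R]_n) (L h : R).
Local Notation T := (caratheodory_type (@lebesgue_outer R n)).
Local Notation mu := (@lebesgue_rV R n).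

Definition cube L : set 'rV[R]_n := box (Some (0, const_mx L)).

Lemma cube_measure L : 0 < L -> mu (cube L) = ((L ^+ n)%:E * mu (cube 1))%E.
Proof.
move=> L0; rewrite [LHS](_ : _ = lebesgue_outer (cube L))//.
rewrite -(outer_image_affine L 0 _ L0); congr lebesgue_outer.
apply/seteqP; split=> [x xL|_ [x x1 <-] i].
  exists (L^-1 *: x); last by rewrite scalerA divff ?gt_eqF// scale1r addr0.
  move=> i; have := xL i; rewrite !mxE pmulr_rgt0 ?invr_gt0// => /andP[-> /=].
  by rewrite ler_pdivrMl// mulr1.
have := x1 i; rewrite !mxE addr0 pmulr_rgt0// => /andP[-> /=].
by rewrite ger_pMr.
Qed.

Lemma unit_cube_measure_fin_num : mu (cube 1) \is a fin_num.
Proof.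
rewrite ge0_fin_numE; last exact: lebesgue_outer_ge0.
apply: le_lt_trans (ltry _).
exact: lebesgue_outer_le_volume (@subset_refl _ _).
Qed.

(** The space is a countable union of rescaled and translated unit cubes; were
these null, so would be every set. *)
Lemma unit_cube_measure_gt0 (E : set 'rV[R]_n) :
  (0 < mu E)%E -> (0 < mu (cube 1))%E.
Proof.
move=> E0; rewrite lt0e lebesgue_outer_ge0 andbT; apply/eqP => c0.
suff : (mu E <= 0)%E by rewrite leNgt E0.
(* [S k] is the cube of all points with coordinates in ]- (k + 1), k + 1]. *)
pose S k := [set (2 * k.+1%:R) *: x + const_mx (- k.+1%:R) | x in cube 1].
have S0 k : lebesgue_outer (S k) = 0%E.
  by rewrite outer_image_affine ?mulr_gt0// [lebesgue_outer _]c0 mule0.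
apply: (@le_trans _ _ (lebesgue_outer (\bigcup_k S k))).
  apply: le_lebesgue_outer => x _.
  pose k := Num.trunc (\sum_j `|x 0 j|); exists k => //.
  have k0 : (0 : R) < 2 * k.+1%:R by rewrite mulr_gt0.
  exists ((2 * k.+1%:R)^-1 *: (x + const_mx k.+1%:R)); last first.
    rewrite scalerA divff ?gt_eqF// scale1r -addrA.
    by apply/rowP => j; rewrite !mxE subrr addr0.
  move=> j; rewrite !mxE.
  have : `|x 0 j| < k.+1%:R.
    apply: le_lt_trans (truncnS_gt _).
    by rewrite (bigD1 j)//= lerDl sumr_ge0.
  rewrite ltr_norml => /andP[xk kx].
  by rewrite pmulr_rgt0 ?invr_gt0// ler_pdivrMl//; apply/andP; split; lra.
by apply: (le_trans (lebesgue_outer_sigma_subadditive S)); rewrite eseries0.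
Qed.

(** The measure [c] of the unit cube is positive, finite and multiplied by
[L ^ n] under scaling, so [L = (m / c) ^ (1 / n)] works whatever [c] is. *)
Lemma exists_cube_measure (m : R) (E : set 'rV[R]_n) : (0 < n)%N -> 0 < m ->
  mu E = m%:E -> exists2 L, 0 < L & mu (cube L) = m%:E.
Proof.
move=> n0 m0 muE.
have c0 : (0 < mu (cube 1))%E.
  by apply: (unit_cube_measure_gt0 E); rewrite muE lte_fin.
have := unit_cube_measure_fin_num.
case: (mu (cube 1)) c0 (cube_measure) => // c.
rewrite lte_fin => c0 cubeE _.
have mc0 : 0 < m / c by rewrite divr_gt0.
exists ((m / c) `^ n%:R^-1); first exact: powR_gt0.
rewrite cubeE ?powR_gt0// -powR_mulrn ?powR_ge0//.
rewrite -powRrM mulVf ?pnatr_eq0 -?lt0n//.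
by rewrite powRr1 ?ltW// -EFinM divfK ?gt_eqF.
Qed.

Lemma coord_le_enorm x i : `|x 0 i| <= enorm x.
Proof.
rewrite -sqrtr_sqr ler_wsqrtr// (bigD1 i)//= lerDl.
by apply: sumr_ge0 => j _; exact: sqr_ge0.
Qed.

Lemma enorm_gt0 x : x != 0 -> 0 < enorm x.
Proof.
case/rV0Pn => i xi0; apply: lt_le_trans (coord_le_enorm x i).
by rewrite normr_gt0.
Qed.

End cube.

(** * The nonlocal perimeter of a cube is finite *)

Section perimeter_cube.
Context {R : realType} {n : nat} (alpha L : R).
Context (alpha_gt0 : 0 < alpha) (alpha_lt1 : alpha < 1) (L0 : 0 < L).
Implicit Types (x y : 'rV[R]_n) (h : R).
Local Notation T := (caratheodory_type (@lebesgue_outer R n)).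
Local Notation mu := (@lebesgue_rV R n).
Local Notation Q := (@cube R n L).

(** A bound for the kernel on the shell of radii [h] and [2 h]. *)
Definition shell_height h : R := (h `^ (n%:R + alpha))^-1.

(** A box containing the ball of centre [y] and radius [2 h]. *)
Definition shell_box h y : set 'rV[R]_n :=
  box (Some (y - const_mx (2 * h), y + const_mx (2 * h))).

(** The slab of width [2 h] along the lower ([true]) or upper ([false]) face
orthogonal to [s.1].  It sticks out of the cube when [2 h > L], which keeps its
volume equal to [2 h L ^ (n - 1)] in all cases. *)
Definition face_slab h (s : 'I_n * bool) : set 'rV[R]_n :=
  box (if s.2 then Some (0, \row_j (if j == s.1 then 2 * h else L))
       else Some (\row_j (if j == s.1 then L - 2 * h else 0), const_mx L)).

Definition face_layer h : set 'rV[R]_n :=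
  \bigcup_(s in [set: 'I_n * bool]) face_slab h s.

Lemma shell_height_ge0 h : 0 <= shell_height h.
Proof. by rewrite invr_ge0 powR_ge0. Qed.

Lemma measurable_face_layer h : measurable (face_layer h : set T).
Proof.
by apply: fin_bigcup_measurable => // s _; exact: measurable_box.
Qed.

Lemma face_slab_measure_le h s : 0 < h ->
  (mu (face_slab h s) <= (2 * h * L ^+ n.-1)%:E)%E.
Proof.
move=> h0; have b0 : 0 <= 2 * h by rewrite mulr_ge0// ltW.
have prodE (i : 'I_n) (F : 'I_n -> R) : F i = 2 * h ->
    (forall j, j != i -> F j = L) -> \prod_j F j = 2 * h * L ^+ n.-1.
  move=> Fi Fj; rewrite (bigD1 i)//= Fi (eq_bigr (fun=> L))//.
  rewrite prodr_const; congr (_ * _ ^+ _).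
  by rewrite (eq_card (B := predC1 i))// cardC1 card_ord.
case: s => i [];
  apply: le_trans (lebesgue_outer_le_volume _ _ _ (@subset_refl _ _)) _;
  rewrite lee_fin /= (_ : \prod_(_ < _) _ = 2 * h * L ^+ n.-1)//;
  apply: (prodE i) => [|j /negbTE ji]; rewrite !mxE ?eqxx ?ji.
- by rewrite subr0 max_r.
- by rewrite subr0 max_r// ltW.
- by rewrite opprB addrC subrK max_r.
- by rewrite subr0 max_r// ltW.
Qed.

Lemma face_layer_measure_le :
  exists2 C : R, 0 <= C &
    forall h, 0 < h -> (mu (face_layer h) <= (C * h)%:E)%E.
Proof.
exists (\sum_(s \in [set: 'I_n * bool]) 2 * L ^+ n.-1).
  rewrite fsbig_finite//=; apply: sumr_ge0 => s _.
  by rewrite mulr_ge0// exprn_ge0// ltW.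
move=> h h0.
apply: (@le_trans _ _ (\sum_(s \in [set: 'I_n * bool]) mu (face_slab h s))%E).
  have finT : finite_set [set: 'I_n * bool] by [].
  apply: (@content_sub_fsum _ R T mu _ _ _ _ finT) => // [s _|].
    exact: measurable_box.
  exact: measurable_face_layer.
rewrite !fsbig_finite//= mulr_suml -sumEFin; apply: lee_sum => s _.
by rewrite mulrAC; exact: face_slab_measure_le.
Qed.

(** Some coordinate of [x] leaves the interval that contains that of [y], and
coordinates differ by less than [2 h]. *)
Lemma face_layer_near h x y : Q y -> ~ Q x -> enorm (x - y) < 2 * h ->
  face_layer h y.
Proof.
move=> Qy /existsNP[i /negP]; rewrite !mxE negb_and -leNgt -ltNge => xi dxy.
have : `|x 0 i - y 0 i| < 2 * h.
  by apply: le_lt_trans dxy; have := coord_le_enorm (x - y) i; rewrite !mxE.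
rewrite ltr_norml => /andP[d1 d2].
have [xi0|Lxi] := orP xi.
- exists (i, true) => // j; have := Qy j; rewrite !mxE => /andP[-> yL] /=.
  by case: eqP => // ->; lra.
- exists (i, false) => // j; have := Qy j; rewrite !mxE => /andP[y0 ->].
  by rewrite andbT; case: eqP => // ->; lra.
Qed.

Lemma shell_box_near h x y : enorm (x - y) < 2 * h -> shell_box h y x.
Proof.
move=> dxy i; have : `|x 0 i - y 0 i| < 2 * h.
  by apply: le_lt_trans dxy; have := coord_le_enorm (x - y) i; rewrite !mxE.
by rewrite ltr_norml !mxE => /andP[d1 d2]; apply/andP; split; lra.
Qed.

Lemma shell_box_measure_le h y : 0 < h ->
  (mu (shell_box h y) <= ((4 * h) ^+ n)%:E)%E.
Proof.
move=> h0.
apply: le_trans (lebesgue_outer_le_volume _ _ _ (@subset_refl _ _)) _.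
rewrite lee_fin /= (eq_bigr (fun=> 4 * h)).
  by rewrite prodr_const card_ord.
move=> i _; rewrite !mxE (_ : _ - _ = 4 * h); last by ring.
by rewrite max_r// mulr_ge0// ltW.
Qed.

(** The contribution of one shell, dominated by a multiple of an indicator
function of [x] times an indicator function of [y]: both integrations become
measures of boxes. *)
Definition shell_term h x y : R :=
  shell_height h * \1_(face_layer h) y * \1_(shell_box h y) x.

Lemma shell_term_ge0 h x y : 0 <= shell_term h x y.
Proof. by rewrite !mulr_ge0// ?shell_height_ge0. Qed.

Lemma kernel_le_shell_term h x y : 0 < h -> Q y -> ~ Q x ->
  h <= enorm (x - y) < 2 * h ->
  (enorm (x - y) `^ (n%:R + alpha))^-1 <= shell_term h x y.
Proof.
move=> h0 Qy Qx /andP[hd dh]; rewrite /shell_term !indicE.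
rewrite (mem_set (face_layer_near _ _ _ Qy Qx dh)).
rewrite (mem_set (shell_box_near _ _ _ dh)).
rewrite !mulr1 lef_pV2 ?posrE ?powR_gt0//; last exact: lt_le_trans hd.
rewrite ge0_ler_powR// ?nnegrE ?addr_ge0 ?(ltW alpha_gt0)// ?(ltW h0)//.
by rewrite (le_trans (ltW h0)).
Qed.

Definition outer_scale (k : nat) : R := 2 ^+ k.
Definition inner_scale (k : nat) : R := 2 ^- k.+1.

(** The point [x - y] lies in exactly one dyadic shell, of inner radius at
least 1 or less than 1; the bound is the corresponding term of one of the two
series. *)
Lemma kernel_le_shell_series x y : Q y -> ~ Q x ->
  (((enorm (x - y) `^ (n%:R + alpha))^-1)%:E <=
   \sum_(0 <= k <oo) (shell_term (outer_scale k) x y)%:E +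
   \sum_(0 <= k <oo) (shell_term (inner_scale k) x y)%:E)%E.
Proof.
move=> Qy Qx; have : 0 < enorm (x - y).
  by apply: enorm_gt0; rewrite subr_eq0; apply: contra_notN Qx => /eqP ->.
have series_ge0 (hs : nat -> R) :
    (0 <= \sum_(0 <= k <oo) (shell_term (hs k) x y)%:E)%E.
  by apply: nneseries_ge0 => k _ _; rewrite lee_fin shell_term_ge0.
have step (hs : nat -> R) k : 0 < hs k -> hs k <= enorm (x - y) < 2 * hs k ->
    (((enorm (x - y) `^ (n%:R + alpha))^-1)%:E <=
    \sum_(0 <= k <oo) (shell_term (hs k) x y)%:E)%E.
  move=> hk hd.
  apply: le_trans (nneseries_ge_term (fun k => shell_term (hs k) x y) k _).
    by rewrite lee_fin kernel_le_shell_term.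
  by move=> j; exact: shell_term_ge0.
move=> /dyadic_shell[[k|k]] hd.
- by rewrite (le_trans (step outer_scale k _ hd))// ?leeDl// exprn_gt0.
- by rewrite (le_trans (step inner_scale k _ hd))// ?leeDr// invr_gt0 exprn_gt0.
Qed.

Lemma measurable_indic_rV (c : R) (A : set T) (D : set T) : measurable A ->
  measurable_fun D (fun x : T => (c * \1_A x)%:E).
Proof.
by move=> mA; apply/measurable_EFinP; apply: measurable_funM.
Qed.

Lemma integral_indic_rV (c : R) (A D : set T) :
  0 <= c -> measurable A -> measurable D ->
  (\int[mu]_(x in D) (c * \1_A x)%:E = c%:E * mu (A `&` D))%E.
Proof.
move=> c0 mA mD; under eq_integral do rewrite EFinM.
have mI : measurable_fun D (fun x : T => (\1_A x : R)%:E).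
  by apply/measurable_EFinP; exact: measurable_indic.
have I0 (x : T) : D x -> (0 <= (\1_A x : R)%:E)%E by move=> _; rewrite lee_fin.
rewrite (@ge0_integralZl_EFin _ T R mu D mD _ I0 mI _ c0).
by rewrite (@integral_indic _ T R mu D mD A mA).
Qed.

(** A bound for the inner integral at [y], once [x] is integrated out. *)
Definition layer_series (hs : nat -> R) y : \bar R :=
  (\sum_(0 <= k <oo) (shell_height (hs k) * (4 * hs k) ^+ n *
                      \1_(face_layer (hs k)) y)%:E)%E.

Let mQ : measurable (Q : set T). Proof. exact: measurable_box. Qed.

Let shell_coef_ge0 h y : 0 <= shell_height h * \1_(face_layer h) y.
Proof. by rewrite mulr_ge0// shell_height_ge0. Qed.

Lemma measurable_shell_series (hs : nat -> R) y :
  measurable_fun (~` Q : set T)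
    (fun x : T => \sum_(0 <= k <oo) (shell_term (hs k) x y)%:E)%E.
Proof.
apply: (@ge0_emeasurable_sum _ T R (~` Q)
  (fun k (x : T) => (shell_term (hs k) x y)%:E) xpredT).
  by move=> k x _ _; rewrite lee_fin shell_term_ge0.
by move=> k _; apply: measurable_indic_rV; exact: measurable_box.
Qed.

Lemma integral_shell_series_le (hs : nat -> R) y : (forall k, 0 < hs k) ->
  (\int[mu]_(x in ~` Q) (\sum_(0 <= k <oo) (shell_term (hs k) x y)%:E) <=
   layer_series hs y)%E.
Proof.
move=> hs0; have mQC : measurable (~` Q : set T) by exact: measurableC.
rewrite (@integral_nneseries _ T R mu (~` Q) mQC
  (fun k (x : T) => (shell_term (hs k) x y)%:E)); last 2 first.
- by move=> k; apply: measurable_indic_rV; exact: measurable_box.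
- by move=> k x _; rewrite lee_fin shell_term_ge0.
apply: lee_nneseries => [k _ _|k _].
  by apply: integral_ge0 => x _; rewrite lee_fin shell_term_ge0.
have mB : measurable (shell_box (hs k) y : set T) by exact: measurable_box.
rewrite (integral_indic_rV _ _ _ (shell_coef_ge0 (hs k) y) mB mQC).
rewrite [in leRHS]mulrAC [in leRHS]EFinM; apply: lee_wpmul2l.
  by rewrite lee_fin shell_coef_ge0.
apply: le_trans (shell_box_measure_le (hs k) y (hs0 k)).
by apply: le_lebesgue_outer => x [].
Qed.

Let layer_coef_ge0 h : 0 < h -> 0 <= shell_height h * (4 * h) ^+ n.
Proof.
move=> h0; rewrite mulr_ge0 ?shell_height_ge0// exprn_ge0// mulr_ge0//.
exact: ltW.
Qed.

Lemma layer_series_ge0 (hs : nat -> R) y : (forall k, 0 < hs k) ->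
  (0 <= layer_series hs y)%E.
Proof.
move=> hs0; apply: nneseries_ge0 => k _ _.
by rewrite lee_fin mulr_ge0// layer_coef_ge0.
Qed.

Lemma measurable_layer_series (hs : nat -> R) : (forall k, 0 < hs k) ->
  measurable_fun (Q : set T) (layer_series hs : T -> \bar R).
Proof.
move=> hs0; apply: (@ge0_emeasurable_sum _ T R Q (fun k (y : T) =>
  (shell_height (hs k) * (4 * hs k) ^+ n *
     \1_(face_layer (hs k)) y)%:E) xpredT).
  by move=> k x _ _; rewrite lee_fin mulr_ge0// layer_coef_ge0.
by move=> k _; apply: measurable_indic_rV; exact: measurable_face_layer.
Qed.

Lemma integral_layer_series (hs : nat -> R) : (forall k, 0 < hs k) ->
  (\int[mu]_(y in Q) layer_series hs y =
   \sum_(0 <= k <oo) (shell_height (hs k) * (4 * hs k) ^+ n)%:E *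
                     mu (face_layer (hs k) `&` Q))%E.
Proof.
move=> hs0; rewrite (@integral_nneseries _ T R mu Q mQ
  (fun k (y : T) => (shell_height (hs k) * (4 * hs k) ^+ n *
                     \1_(face_layer (hs k)) y)%:E)); last 2 first.
- by move=> k; apply: measurable_indic_rV; exact: measurable_face_layer.
- by move=> k x _; rewrite lee_fin mulr_ge0// layer_coef_ge0.
apply: eq_eseriesr => k _.
exact: (integral_indic_rV _ _ _ (layer_coef_ge0 (hs k) (hs0 k))
  (measurable_face_layer (hs k)) mQ).
Qed.

(** The powers of [h] of order [n] cancel: what is left of a shell is
[h ^ - alpha]. *)
Lemma shell_height_box_volume h : 0 < h ->
  shell_height h * (4 * h) ^+ n = 4 ^+ n * (h `^ alpha)^-1.
Proof.
move=> h0; rewrite /shell_height powRD; last by rewrite (gt_eqF h0) implybT.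
rewrite powR_mulrn ?(ltW h0)// invfM exprMn.
have hn : h ^+ n != 0 by rewrite expf_neq0// gt_eqF.
by field; rewrite hn gt_eqF// powR_gt0.
Qed.

Lemma outer_scale_gt0 k : 0 < outer_scale k.
Proof. by rewrite exprn_gt0. Qed.

Lemma inner_scale_gt0 k : 0 < inner_scale k.
Proof. by rewrite invr_gt0 exprn_gt0. Qed.

Lemma pow2_expr_powR k : (2 ^+ k : R) `^ alpha = (2 `^ alpha) ^+ k.
Proof.
elim: k => [|k IHk]; first by rewrite !expr0 powR1.
by rewrite exprS powRM ?exprn_ge0// IHk -exprS.
Qed.

Lemma inner_scale_powR k : inner_scale k `^ alpha = (2 `^ alpha) ^- k.+1.
Proof.
rewrite -pow2_expr_powR /inner_scale -[in LHS]powR_inv1 ?exprn_ge0//.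
by rewrite (powRAC (2 ^+ k.+1) (-1) alpha) powR_inv1// powR_ge0.
Qed.

Let pow2_alpha_gt1 : 1 < (2 : R) `^ alpha.
Proof. by rewrite -[X in X < _](powRr0 2) ltr_pow2R. Qed.

Let pow2_alpha_lt2 : (2 : R) `^ alpha < 2.
Proof. by rewrite -[X in _ < X]powRr1// ltr_pow2R. Qed.

(** At large scales the layer counts for at most the whole cube, and the terms
decay like [(2 ^ - alpha) ^ k]. *)
Lemma integral_outer_layers_lty :
  (\int[mu]_(y in Q) layer_series outer_scale y < +oo)%E.
Proof.
rewrite integral_layer_series; last exact: outer_scale_gt0.
have QV : (mu Q <= (L ^+ n)%:E)%E.
  apply: le_trans (lebesgue_outer_le_volume _ _ _ (@subset_refl _ _)) _.
  rewrite lee_fin /= (eq_bigr (fun=> L)) ?prodr_const ?card_ord// => i _.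
  by rewrite !mxE subr0 max_r// ltW.
have A0 : 0 < (2 : R) `^ alpha by rewrite powR_gt0.
apply: le_lt_trans
  (geometric_nneseries_lty (4 ^+ n * L ^+ n) (2 `^ alpha)^-1 _ _); last 2 first.
- by rewrite mulr_ge0 ?exprn_ge0// ltW.
- by rewrite invr_gt0 A0 invf_lt1.
apply: lee_nneseries => [k _ _|k _].
  rewrite mule_ge0 ?lebesgue_outer_ge0// lee_fin layer_coef_ge0//.
  exact: outer_scale_gt0.
rewrite (shell_height_box_volume _ (outer_scale_gt0 k)) pow2_expr_powR.
rewrite [in leRHS]mulrAC [in leRHS]exprVn [in leRHS]EFinM; apply: lee_wpmul2l.
  by rewrite lee_fin mulr_ge0 ?exprn_ge0// invr_ge0 exprn_ge0 ?ltW.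
by apply: le_trans QV; apply: le_lebesgue_outer => y [].
Qed.

(** At small scales the layer has measure of order [h], and [h ^ (1 - alpha)]
with [h = 2 ^ - (k + 1)] is a geometric sequence of ratio [2 ^ alpha / 2]. *)
Lemma integral_inner_layers_lty :
  (\int[mu]_(y in Q) layer_series inner_scale y < +oo)%E.
Proof.
rewrite integral_layer_series; last exact: inner_scale_gt0.
have [C C0 layerC] := face_layer_measure_le.
have A0 : 0 < (2 : R) `^ alpha by rewrite powR_gt0.
have q0 : 0 < (2 : R) `^ alpha / 2 by rewrite divr_gt0.
apply: le_lt_trans (geometric_nneseries_lty
  (4 ^+ n * C * (2 `^ alpha / 2)) (2 `^ alpha / 2) _ _); last 2 first.
- by rewrite !mulr_ge0 ?exprn_ge0// ltW.
- by rewrite q0 ltr_pdivrMr// mul1r.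
apply: lee_nneseries => [k _ _|k _].
  rewrite mule_ge0 ?lebesgue_outer_ge0// lee_fin layer_coef_ge0//.
  exact: inner_scale_gt0.
have -> : 4 ^+ n * C * (2 `^ alpha / 2) * (2 `^ alpha / 2) ^+ k =
    (4 ^+ n * (inner_scale k `^ alpha)^-1) * (C * inner_scale k).
  rewrite -[LHS]mulrA -exprS expr_div_n inner_scale_powR invrK /inner_scale.
  by move: (_ ^+ _) (_ ^- _) => u v; ring.
rewrite (shell_height_box_volume _ (inner_scale_gt0 k)) [in leRHS]EFinM.
apply: lee_wpmul2l.
  by rewrite lee_fin mulr_ge0 ?exprn_ge0// invr_ge0 powR_ge0.
apply: le_trans (layerC _ (inner_scale_gt0 k)).
by apply: le_lebesgue_outer => y [].
Qed.

(** Both integrals are bounded by those of the two shell series, which are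
integrated term by term. *)
Lemma nonlocal_perimeter_cube_lty : (nonlocal_perimeter alpha Q < +oo)%E.
Proof.
apply: (@le_lt_trans _ _ (\int[mu]_(y in Q)
    (layer_series outer_scale y + layer_series inner_scale y))%E); last first.
  have o0 (y : T) : Q y -> (0 <= layer_series outer_scale y)%E.
    by move=> _; apply: layer_series_ge0 => k; exact: outer_scale_gt0.
  have i0 (y : T) : Q y -> (0 <= layer_series inner_scale y)%E.
    by move=> _; apply: layer_series_ge0 => k; exact: inner_scale_gt0.
  have mo := measurable_layer_series outer_scale outer_scale_gt0.
  have mi := measurable_layer_series inner_scale inner_scale_gt0.
  rewrite [ltLHS](@ge0_integralD _ T R mu Q mQ _ _ o0 mo i0 mi).
  apply: lte_add_pinfty; first exact: integral_outer_layers_lty.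
  exact: integral_inner_layers_lty.
have mQC : measurable (~` Q : set T) by exact: measurableC.
apply: ge0_le_integral_arbitrary => y Qy.
  by apply: integral_ge0 => x _; rewrite lee_fin invr_ge0 powR_ge0.
apply: (@le_trans _ _ (\int[mu]_(x in ~` Q)
   (\sum_(0 <= k <oo) (shell_term (outer_scale k) x y)%:E +
    \sum_(0 <= k <oo) (shell_term (inner_scale k) x y)%:E))%E).
  apply: ge0_le_integral_arbitrary => x Qx.
    by rewrite lee_fin invr_ge0 powR_ge0.
  exact: kernel_le_shell_series.
have series_ge0 (hs : nat -> R) (x : T) :
    (0 <= \sum_(0 <= k <oo) (shell_term (hs k) x y)%:E)%E.
  by apply: nneseries_ge0 => k _ _; rewrite lee_fin shell_term_ge0.
rewrite [leLHS](@ge0_integralD _ T R mu (~` Q) mQC _ _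
  (fun x _ => series_ge0 outer_scale x) (measurable_shell_series outer_scale y)
  (fun x _ => series_ge0 inner_scale x)
  (measurable_shell_series inner_scale y)).
apply: leeD; apply: integral_shell_series_le.
  exact: outer_scale_gt0.
exact: inner_scale_gt0.
Qed.

End perimeter_cube.

(** * Nonexistence of minimizers *)

Lemma ray_potential_le_cube {R : realType} {n : nat} (i j : 'I_n) (L : R) x :
  cube L x -> ray_potential i j x <= L.
Proof.
move=> xL; have := xL i; have := xL j.
rewrite !mxE /ray_potential /radial_excess.
move: (x 0 i) (x 0 j) => u v /andP[v0 vL] /andP[u0 _].
have := sqrt_sumsq_triangle u 0 0 v.
by rewrite !addr0 !add0r expr0n/= addr0 add0r !sqrtr_sqr !gtr0_norm//; lra.
Qed.

Lemma free_energy_cube_lty {R : realType} {n : nat} (i j : 'I_n) (alpha L : R) :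
  0 < alpha -> alpha < 1 -> 0 < L ->
  (free_energy alpha (ray_potential i j) (cube L) < +oo)%E.
Proof.
move=> a0 a1 L0; apply: lte_add_pinfty.
  exact: nonlocal_perimeter_cube_lty.
pose T := caratheodory_type (@lebesgue_outer R n).
apply: (@le_lt_trans _ _
  (\int[@lebesgue_rV R n]_(x in cube L) (L%:E : \bar R))%E).
  apply: ge0_le_integral_arbitrary => x xL; rewrite lee_fin.
    exact: radial_excess_ge0.
  exact: ray_potential_le_cube.
have mQ : measurable (cube L : set T) := measurable_box _.
rewrite (@integral_cst _ T R (@lebesgue_rV R n) (cube L) mQ L%:E).
apply: lte_mul_pinfty => //; first by rewrite lee_fin ltW.
apply: le_lt_trans (ltry (box_volume (Some (0, const_mx L)))).
exact: lebesgue_outer_le_volume.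
Qed.

Theorem theorem3p6 (R : realType) (n : nat) (alpha : R)
    (n_ge2 : (2 <= n)%N) (alpha_gt0 : 0 < alpha) (alpha_lt1 : alpha < 1) :
  exists g : 'rV[R]_n -> R,
    [/\ convex_function [set: 'rV[R]_n] g,
        (forall x, 0 <= g x),
        g 0 = 0 &
        forall m : R, 0 < m -> ~ (exists E, is_minimizer alpha g m E)].
Proof.
pose i : 'I_n := Ordinal (ltnW n_ge2); pose j : 'I_n := Ordinal n_ge2.
exists (ray_potential i j); split.
- exact: ray_potential_convex.
- by move=> x; exact: radial_excess_ge0.
- by rewrite /ray_potential /radial_excess !mxE expr0n/= addr0 sqrtr0 subr0.
move=> m m0 [E [adE minE]]; have [mE muE] := adE.
have [L L0 muQ] := exists_cube_measure m E (ltnW n_ge2) m0 muE.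
(* Comparison with a cube makes the energy of the minimizer finite. *)
have E_lty : (free_energy alpha (ray_potential i j) E < +oo)%E.
  apply: le_lt_trans (free_energy_cube_lty i j alpha L alpha_gt0 alpha_lt1 L0).
  rewrite minE; apply: ereal_inf_lbound; exists (cube L) => //.
  by split => //; exact: measurable_box.
have PE0 := nonlocal_perimeter_ge0 alpha E.
have GE0 := potential_energy_ge0 (ray_potential i j) E
  (fun x => radial_excess_ge0 _ _).
have P_fin : nonlocal_perimeter alpha E \is a fin_num.
  by rewrite ge0_fin_numE//; apply: le_lt_trans E_lty; rewrite leeDl.
have G_lty : (potential_energy (ray_potential i j) E < +oo)%E.
  by apply: le_lt_trans E_lty; rewrite leeDr.
have E0 : (0 < @lebesgue_rV R n E)%E by rewrite muE lte_fin.
have := potential_energy_translation_lt i j E isT mE E0 G_lty.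
apply/negP; rewrite -leNgt -(leeD2lE _ _ P_fin).
rewrite -[in leRHS](nonlocal_perimeter_translation alpha (- delta_mx 0 i) E).
apply: (@le_trans _ _ (free_energy alpha (ray_potential i j) E)).
  exact: lexx.
rewrite minE; apply: ereal_inf_lbound.
exists ((fun x => x - delta_mx 0 i) @^-1` E) => //.
exact: admissible_translation.
Qed.
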